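(* Let $f=a_0+a_1z+\cdots+a_nz^n\in\mathbb{Z}[z]$ be a primitive polynomial with $a_0a_n\neq 0$, and let $\Delta_f$ be a positive integer as in the context. Suppose there exist natural numbers $m,d,k$ and a prime $p\nmid d$ with $(m-1-h_f)^{\Delta_f}\geq d$ such that $s_n(m)=\pm p^kd$ and $|s_0(m)/q|\leq|s_n(m)|$, where $q$ is the smallest prime divisor of $s_0(m)$. Then $f$ is a product of at most $$\min_{1\leq i\leq n}\{k,\ i+v_p(s_{n-i}(m))\}$$ irreducible factors in $\mathbb{Z}[z]$. In particular, if $k=1$ or $p\nmid s_{n-1}(m)$, then $f$ is irreducible in $\mathbb{Z}[z]$.
   Context: For $f=a_0+\cdots+a_nz^n$ with $a_n\neq0$, the height is $h_f=\max_{0\leq i\leq n-1}|a_i|/|a_n|$. For $i=0,\ldots,n$, $s_i(z)=f^{(i)}(z)/i!\in\mathbb{Z}[z]$, with $f^{(i)}$ the $i$-th formal derivative ($s_0=f$, $s_n=a_n$). $\Delta_f$ denotes a natural number with $\Delta_f\leq\deg f$ such that every nonconstant factor of $f$ in $\mathbb{Z}[z]$ has degree at least $\Delta_f$. Primitive means the gcd of coefficients is $1$. $v_p(a)$ is the exponent of the prime $p$ in the nonzero integer $a$, and $v_p(0)=\infty$.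
   Formalization: The formal theorem additionally assumes m ≥ 1 + h_f (and reads m, d, k as positive); without it the claim fails for even Δ_f, e.g. f = (z²−z+1)(2z²+1), m = 1, p = 2, d = k = 1, Δ_f = 2. *)

(* Defs.v *)
From mathcomp Require Import all_boot all_order all_algebra.
From mathcomp Require Import constructive_ereal.

Set Implicit Arguments.
Unset Strict Implicit.
Unset Printing Implicit Defensive.

Import Order.TTheory GRing.Theory Num.Theory.
Local Open Scope ring_scope.

(* The maximum is over the coefficients below the leading one; all the terms
   are nonnegative, so the initial value 0 only matters when f is constant. *)
Definition height (f : {poly int}) : rat :=
  \big[Num.max/0]_(0 <= i < (size f).-1) (`|f`_i|%:Q / `|lead_coef f|%:Q).

Definition primitive (f : {poly int}) : Prop :=
  \big[gcdn/0%N]_(i < size f) absz f`_i = 1%N.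

(* The divisibility %| of polydiv is pseudo-division, i.e. divisibility over
   the fraction field, hence the explicit divisibility in Z[z] below. *)
Definition factor_degree_bound (f : {poly int}) (D : nat) : Prop :=
  forall g h : {poly int}, f = g * h -> (1 < size g)%N -> (D <= (size g).-1)%N.

Definition vp (p : nat) (a : int) : \bar int :=
  if a == 0 then +oo%E else (logn p `|a|%N)%:Z%:E.

Definition smallest_prime_divisor (q : nat) (a : int) : Prop :=
  [/\ prime q, (q%:Z %| a)%Z
    & forall r : nat, prime r -> (r%:Z %| a)%Z -> (q <= r)%N].

(* irreducible_poly from polydiv is meant for polynomials over a field: it
   ignores constant factors such as 2 in Z[z]. *)
Definition irreducible_elt (R : idomainType) (x : R) : Prop :=
  [/\ x != 0, x \isn't a GRing.unit
    & forall a b : R, x = a * b -> a \is a GRing.unit \/ b \is a GRing.unit].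

Definition product_of_at_most (R : idomainType) (x : R) (N : \bar int) : Prop :=
  exists s : seq R,
    [/\ x = \prod_(g <- s) g, (forall g, g \in s -> irreducible_elt g)
      & ((size s)%:Z%:E <= N)%E].

(* Main.v *)
(* The roots of f have modulus less than 1 + h_f, so |g(m)| > d |lc g| for every
   nonconstant factor g of f. If f = g h with both factors nonconstant, then
   |g(m)| >= q, hence d |lc h| < |h(m)| <= |f(m)| / q <= p^k d, i.e.
   |lc h| < p^k; as lc g lc h = +-p^k d with p not dividing d, p divides lc g.
   Thus all r irreducible factors of f have leading coefficient divisible by p.
   Expanding the product of the g(z + m), every term contributing to the
   coefficient s_{n-i}(m) of z^(n-i) involves at least r - i leading
   coefficients, so p^(r-i) divides s_{n-i}(m); i = 0 gives r <= k. *)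
Require Import Defs.
From mathcomp Require Import all_boot all_order all_algebra all_field.
From mathcomp Require Import constructive_ereal.
From mathcomp Require Import zify.
From Stdlib Require Import Classical.

Set Implicit Arguments.
Unset Strict Implicit.
Unset Printing Implicit Defensive.

Import Order.TTheory GRing.Theory Num.Theory.
Local Open Scope ring_scope.

(** If [|x| >= 1 + H], then [H <= |x| - 1], so the terms below the leading one sum in modulus to at
    most [|lc f| (|x| - 1) (1 + ... + |x|^(n-1)) = |lc f| (|x|^n - 1)], too little to cancel the
    leading term. *)
Lemma cauchy_root_bound (R : numFieldType) (f : {poly R}) (H x : R) :
  0 <= H -> f != 0 -> root f x ->
  (forall i, (i < (size f).-1)%N -> `|f`_i| <= H * `|lead_coef f|) ->
  `|x| < 1 + H.
Proof.
move=> H0 f0 /rootP fx0 fH.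
rewrite real_ltNge ?ger0_real ?normr_ge0 ?addr_ge0 //; apply/negP => Hx.
have sf : size f = (size f).-1.+1 by rewrite prednK // size_poly_gt0.
move: fx0; rewrite horner_coef sf big_ord_recr /= -lead_coefE => /eqP.
set n := (size f).-1 in fH *; rewrite addr_eq0 => /eqP fx0.
have lc0 : 0 < `|lead_coef f| by rewrite normr_gt0 lead_coef_eq0.
have : `|lead_coef f| * `|x| ^+ n <= `|lead_coef f| * (`|x| ^+ n - 1).
  rewrite subrX1 mulrA mulr_sumr -normrX -normrM -normrN -fx0.
  apply: le_trans (ler_norm_sum _ _ _) (ler_sum _ _) => i _.
  rewrite normrM normrX ler_wpM2r ?exprn_ge0 //.
  apply: le_trans (fH _ (ltn_ord i)) _.
  by rewrite mulrC ler_pM2l // lerBrDl.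
by rewrite ler_pM2l // lerBrDl gerDr ler10.
Qed.

(** Split [g] into linear factors: each root [z] contributes [|x - z| >= x - |z| > x - B]. *)
Lemma norm_horner_gt (C : numClosedFieldType) (g : {poly C}) (B x : C) :
  (1 < size g)%N -> B <= x -> 0 <= x -> (forall z, root g z -> `|z| < B) ->
  `|lead_coef g| * (x - B) ^+ (size g).-1 < `|g.[x]|.
Proof.
move=> sg Bx x0 gB.
have g0 : g != 0 by rewrite -size_poly_gt0 ltnW.
have [r gr] := closed_field_poly_normal g.
have lc0 : lead_coef g != 0 by rewrite lead_coef_eq0.
have sr : size g = (size r).+1 by rewrite {1}gr size_scale // size_prod_XsubC.
have {gB} : forall z, z \in r -> `|z| < B.
  by move=> z zr; apply: gB; rewrite gr rootZ // root_prod_XsubC.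
rewrite {3}gr sr hornerZ normrM horner_prod ltr_pM2l ?normr_gt0 //= normr_prod.
(* The strict inequality fails for an empty product, so the induction runs over nonempty lists of
   roots. *)
have : r != [::] by rewrite -size_eq0 -lt0n -ltnS -sr.
elim: r {g sg g0 gr lc0 sr} => // z r IH _ rB.
have zx : x - B < `|x - z|.
  apply: lt_le_trans (lerB_dist _ _).
  by rewrite ger0_norm // ltrD2l ltrN2 rB ?mem_head.
rewrite big_cons hornerXsubC /= exprS.
have [->|r0] := eqVneq r [::]; first by rewrite big_nil !mulr1.
rewrite ltr_pM ?exprn_ge0 ?subr_ge0 //; apply: IH => // w wr.
by rewrite rB // in_cons wr orbT.
Qed.

Lemma height_ge0 (f : {poly int}) : 0 <= height f.
Proof. by apply: bigmax_ge_id. Qed.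

Lemma coef_le_height (f : {poly int}) i : f != 0 -> (i < (size f).-1)%N ->
  `|f`_i|%:Q <= height f * `|lead_coef f|%:Q.
Proof.
move=> f0 lti; rewrite -ler_pdivrMr; last first.
  by rewrite ltr0z normr_gt0 lead_coef_eq0.
rewrite /height big_mkord.
exact: (le_bigmax _ (fun j : 'I__ => `|f`_j|%:Q / `|lead_coef f|%:Q)
          (Ordinal lti)).
Qed.

(* Used with C := algC; on the concrete field the rewriting of ratr diverges. *)
Lemma factor_value_gt (C : numClosedFieldType) (f g h : {poly int})
    (D m d : nat) :
  f != 0 -> f = g * h -> (1 < size g)%N -> factor_degree_bound f D ->
  (0 < D)%N -> (0 < d)%N -> 1 + height f <= m%:R ->
  d%:R <= (m%:R - 1 - height f) ^+ D ->
  (`|lead_coef g| * d < `|g.[m%:Z]|)%N.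
Proof.
move=> f0 fgh sg fD D0 d0 fm fd.
pose toC := map_poly (intr : int -> C).
have inj : injective (intr : int -> C) := intr_inj.
have szC u : size (toC u) = size u by rewrite size_map_inj_poly.
have lcC u : lead_coef (toC u) = (lead_coef u)%:~R.
  by rewrite lead_coef_map_inj.
have rootB z : root (toC g) z -> `|z| < ratr (1 + height f).
  move=> gz; rewrite rmorphD rmorph1.
  apply: (@cauchy_root_bound _ (toC f)).
  - by rewrite ler0q height_ge0.
  - by rewrite -size_poly_gt0 szC size_poly_gt0.
  - by rewrite fgh /toC rmorphM rootM gz.
  - move=> i; rewrite szC lcC coef_map /= => /(coef_le_height f0).
    by rewrite -(ler_rat C) rmorphM /= !ratr_int !intr_norm.
have t0 : 0 <= m%:R - 1 - height f by rewrite -addrA -opprD subr_ge0.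
(* A nonnegative base below 1 would have its [D]-th power below [1 <= d]. With base at least 1, the
   exponent can be raised from [D] to the degree of [g]. *)
have t1 : 1 <= m%:R - 1 - height f.
  rewrite leNgt; apply/negP => t1; have := expr_lt1 D0 t0; rewrite t1 ltNge.
  by rewrite (le_trans _ fd) // ler1n.
have xB : ratr (1 + height f) <= m%:R :> C by rewrite -(ratr_nat C) ler_rat.
have gt : `|lead_coef g|%:Q * (m%:R - (1 + height f)) ^+ (size g).-1
          < `|g.[m%:Z]|%:Q.
  rewrite -(ltr_rat C) rmorphM rmorphXn rmorphB /=.
  rewrite !ratr_int ratr_nat !intr_norm.
  have := norm_horner_gt _ xB (ler0n _ _) rootB.
  rewrite szC lcC => /(_ sg).
  by have -> : (toC g).[m%:R] = (g.[m%:Z])%:~R by rewrite -horner_map.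
rewrite -(ltr_nat rat) natrM !natr_absz; apply: le_lt_trans gt.
rewrite ler_wpM2l ?ler0z ?normr_ge0 // (le_trans fd) // opprD addrA.
by rewrite ler_weXn2l // (fD g h).
Qed.

(* The subtraction is truncated, which is what makes the statement hold for
   all j and lets the exponents of two factors be added up. *)
Lemma dvdn_coef_prod (p : nat) (s : seq {poly int}) j :
  (forall g, g \in s -> g != 0 /\ (p%:Z %| lead_coef g)%Z) ->
  (p%:Z ^+ (size s + j - (size (\prod_(g <- s) g)%R).-1) %|
     (\prod_(g <- s) g)`_j)%Z.
Proof.
elim: s j => [|g s IH] j sp.
  rewrite big_nil size_poly1 add0n subn0 coef1.
  by case: j => [|j]; rewrite ?dvdz0 // dvdzz.
have [g0 pg] := sp g (mem_head _ _).
have {}sp u : u \in s -> u != 0 /\ (p%:Z %| lead_coef u)%Z.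
  by move=> us; apply: sp; rewrite in_cons us orbT.
rewrite big_cons; set G := \prod_(u <- s) u in IH *.
have G0 : G != 0 by rewrite prodf_seq_neq0; apply/allP => u /sp[].
rewrite size_mul // coefM rpred_sum // => -[i /=]; rewrite ltnS => ij _.
(* The exponent is 0 below the degree of [g] and 1 at the degree; above it the coefficient
   vanishes. *)
have gi : (p%:Z ^+ (1 + i - (size g).-1) %| g`_i)%Z.
  have [lti|] := ltnP i (size g).-1.
    by rewrite (eqP (_ : _ - _ == 0)%N) ?dvd1z ?subn_eq0.
  rewrite leq_eqVlt => /predU1P[<-|]; first by rewrite addnK expr1.
  by move=> /(leq_trans (leqSpred _))/leq_sizeP ->; rewrite ?dvdz0.
apply: dvdz_trans (dvdz_mul gi (IH (j - i)%N sp)).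
rewrite -exprD dvdz_exp2l //=.
(* Both sizes are positive, so the predecessors in the degrees do not truncate. *)
move: g0 G0; rewrite -!size_poly_gt0.
move: (size g) (size G) (size s) => a b c; clear -ij; lia.
Qed.

(** The constant divides every coefficient of [f], hence their gcd, which is 1. *)
Lemma primitive_const_factor (f c h : {poly int}) :
  primitive f -> f = c * h -> (size c <= 1)%N -> c \is a GRing.unit.
Proof.
move=> fp fch /size1_polyC cE.
have : (absz (c`_0)%R %| 1)%N.
  rewrite -fp; elim/big_ind: _ => [|u v cu cv|i _]; first exact: dvdn0.
    by rewrite dvdn_gcd cu.
  have fE j : f`_j = c`_0 * h`_j by rewrite fch [in LHS]cE coefCM.
  by rewrite fE abszM dvdn_mulr.
rewrite dvdn1 cE poly_unitE size_polyC !coefC /=.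
by case: (c`_0)%R => [[|[|a]]|[|a]].
Qed.

(** The hypothesis on constants is primitivity in a form that passes to factors. It makes both parts
    of a nontrivial splitting nonconstant, so the size drops and strong induction applies. *)
Lemma primitive_factorization (f : {poly int}) :
  (1 < size f)%N ->
  (forall c h, f = c * h -> (size c <= 1)%N -> c \is a GRing.unit) ->
  exists2 s : seq {poly int}, f = \prod_(g <- s) g
    & forall g, g \in s -> (1 < size g)%N /\ irreducible_elt g.
Proof.
have [N] := ubnP (size f); elim: N f => // N IH f fN f1 fc.
have f0 : f != 0 by rewrite -size_poly_gt0 ltnW.
have fu : f \isn't a GRing.unit by rewrite poly_unitE (gtn_eqF f1).
have [fi|] := classic (irreducible_elt f).
  by exists [:: f]; rewrite ?big_seq1 // => g; rewrite inE => /eqP ->.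
move=> fi; have [a [b [fab /negP au /negP bu]]] :
    exists a b, [/\ f = a * b, ~ a \is a GRing.unit & ~ b \is a GRing.unit].
  apply: NNPP => H; apply: fi; split=> // a b fab.
  have [|/negP au] := boolP (a \is a GRing.unit); first by left.
  have [|/negP bu] := boolP (b \is a GRing.unit); first by right.
  by case: H; exists a, b; split.
have a1 : (1 < size a)%N.
  by rewrite ltnNge; apply: contra au; apply: fc fab.
have b1 : (1 < size b)%N.
  by rewrite ltnNge; apply: contra bu; apply: fc (etrans fab (mulrC _ _)).
have sf : size f = (size a + size b).-1.
  by rewrite fab size_mul // -size_poly_gt0 ltnW.
have [|||s aE sP] := IH a; rewrite ?a1 //; first lia.
  by move=> c h ach; apply: (fc c (h * b)); rewrite fab ach mulrA.
have [|||r bE rP] := IH b; rewrite ?b1 //; first lia.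
  by move=> c h bch; apply: (fc c (h * a)); rewrite fab bch mulrC mulrA.
exists (s ++ r); first by rewrite big_cat fab /= -aE -bE.
by move=> g; rewrite mem_cat => /orP[/sP|/rP].
Qed.

(** Taylor expansion at [a], carried out over the polynomial ring with the coefficients of [f]
    lifted to constants. It presents the [s_i(m)] as the coefficients of [f(X + m)]. *)
Lemma coef_comp_XaddC (f : {poly int}) a i :
  (f \Po ('X + a%:P))`_i = f^`N(i).[a].
Proof.
rewrite /comp_poly addrC nderiv_taylor; last exact: mulrC.
have -> : \sum_(j < size (map_poly polyC f))
    (map_poly polyC f)^`N(j).[a%:P] * 'X^j = \poly_(j < size f) f^`N(j).[a].
  rewrite poly_def size_map_inj_poly //; last exact: polyC_inj.
  by apply: eq_bigr => j _; rewrite nderivn_map horner_map mul_polyC.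
rewrite coef_poly; case: ltnP => // fi.
by rewrite nderivn_poly0 ?horner0.
Qed.

Theorem theorem5 (f : {poly int}) (n Delta m d k p q : nat)
    (f_deg : size f = n.+1)
    (f_prim : primitive f)
    (f_0n : f`_0 * f`_n != 0)
    (Delta_gt0 : (0 < Delta)%N)
    (Delta_le : (Delta <= n)%N)
    (Delta_bound : factor_degree_bound f Delta)
    (m_gt0 : (0 < m)%N) (d_gt0 : (0 < d)%N) (k_gt0 : (0 < k)%N)
    (p_prime : prime p)
    (p_ndvd_d : ~~ (p %| d)%N)
    (m_ge : 1 + height f <= m%:R)
    (m_d : (m%:R - 1 - height f) ^+ Delta >= d%:R)
    (sn_m : f^`N(n).[m%:Z] = p%:Z ^+ k * d%:Z \/
            f^`N(n).[m%:Z] = - (p%:Z ^+ k * d%:Z))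
    (q_min : smallest_prime_divisor q f^`N(0).[m%:Z])
    (s0_m : `|f^`N(0).[m%:Z]%:Q / q%:Q| <= `|f^`N(n).[m%:Z]|%:Q) :
  product_of_at_most f
    (\big[Order.min/k%:Z%:E]_(1 <= i < n.+1)
       (i%:Z%:E + vp p f^`N(n - i).[m%:Z]))%E
  /\ (k = 1%N \/ ~~ (p%:Z %| f^`N(n - 1).[m%:Z])%Z -> irreducible_elt f).
Proof.
have n0 : (0 < n)%N by apply: leq_trans Delta_le.
have f0 : f != 0 by rewrite -size_poly_gt0 f_deg.
have f1 : (1 < size f)%N by rewrite f_deg.
have shiftE i : f^`N(i).[m%:Z] = (f \Po ('X + m%:Z%:P))`_i
  by rewrite coef_comp_XaddC.
have size_shift (g : {poly int}) : size (g \Po ('X + m%:Z%:P)) = size g.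
  by rewrite size_comp_poly2 // size_XaddC.
have lc_shift (g : {poly int}) : lead_coef (g \Po ('X + m%:Z%:P)) = lead_coef g.
  by rewrite lead_coef_comp ?size_XaddC // lead_coefXaddC expr1n mulr1.
have fnE : f^`N(n).[m%:Z] = lead_coef f.
  by rewrite shiftE -lc_shift lead_coefE size_shift f_deg.
have lcf : `|lead_coef f|%N = (p ^ k * d)%N.
  by rewrite -fnE; case: sn_m => ->; rewrite ?abszN abszM abszX.
have f_m : f^`N(0).[m%:Z] = f.[m%:Z] by rewrite nderivn0.
rewrite f_m in q_min s0_m; rewrite fnE in s0_m.
have [q_prime q_dvd q_le] := q_min.
have s0_m' : (`|f.[m%:Z]| <= q * (p ^ k * d))%N.
  have q0 : 0 < q%:Q by rewrite ltr0z ltz_nat prime_gt0.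
  move: s0_m; rewrite normrM normfV (gtr0_norm q0) ler_pdivrMr //.
  by rewrite -!intr_norm -rmorphM ler_int -!abszE -PoszM lez_nat lcf mulnC.
have p_lead g h : f = g * h -> (1 < size g)%N -> (1 < size h)%N ->
    (p%:Z %| lead_coef g)%Z.
  move=> fgh g1 h1.
  have hf := factor_value_gt algC f0 fgh g1 Delta_bound Delta_gt0
    d_gt0 m_ge m_d.
  have fhg : f = h * g by rewrite mulrC.
  have hh := factor_value_gt algC f0 fhg h1 Delta_bound Delta_gt0
    d_gt0 m_ge m_d.
  have lcgh : (`|lead_coef g| * `|lead_coef h| = p ^ k * d)%N.
    by rewrite -abszM -lead_coefM -fgh.
  have fmE : (`|f.[m%:Z]| = `|g.[m%:Z]| * `|h.[m%:Z]|)%N.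
    by rewrite fgh hornerM abszM.
  have pkd_gt0 : (0 < p ^ k * d)%N by rewrite muln_gt0 expn_gt0 prime_gt0.
  have [lg0 lh0] : (0 < `|lead_coef g| /\ 0 < `|lead_coef h|)%N.
    by apply/andP; rewrite -muln_gt0 lcgh.
  (* As [|g(m)| > 1], it has a prime divisor; this also divides [f(m)], so it is at least [q]. *)
  have q_le_g : (q <= `|g.[m%:Z]|)%N.
    have gm1 : (1 < `|g.[m%:Z]|)%N.
      by apply: leq_ltn_trans hf; rewrite muln_gt0 lg0.
    apply: leq_trans (pdiv_leq (ltnW gm1)); apply: q_le (pdiv_prime gm1) _.
    by rewrite dvdzE fmE dvdn_mulr // pdiv_dvd.
  have lh : (`|lead_coef h| < p ^ k)%N.
    rewrite -(ltn_pmul2r d_gt0); apply: leq_trans hh _.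
    rewrite -(leq_pmul2l (prime_gt0 q_prime)); apply: leq_trans s0_m'.
    by rewrite fmE leq_mul2r q_le_g orbT.
  (* Otherwise [p^k] is coprime to [lc g], so it divides the nonzero [lc h] and cannot exceed it. *)
  rewrite dvdzE; apply: contraLR lh => pg; rewrite -leqNgt dvdn_leq //.
  rewrite -(@Gauss_dvdr _ `|lead_coef g|%N) ?lcgh ?dvdn_mulr //.
  by rewrite coprimeXl // prime_coprime.
have [s fs sP] : exists2 s : seq {poly int}, f = \prod_(g <- s) g
    & forall g, g \in s -> (1 < size g)%N /\ irreducible_elt g.
  apply: primitive_factorization => // c h; exact: primitive_const_factor.
have s0 : s != [::].
  by apply: contraTneq f1 => s0; rewrite fs s0 big_nil size_poly1.
have p_s g : g \in s -> g != 0 /\ (p%:Z %| lead_coef g)%Z.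
  move=> gs; have [g1 _] := sP g gs.
  split; first by rewrite -size_poly_gt0 ltnW.
  have fgr : f = g * \prod_(u <- rem g s) u by rewrite fs (big_rem g).
  (* If other factors remain, their product is nonconstant and [p_lead] applies; if none does,
     [g = f], and [p] divides [lc f] because [k > 0]. *)
  case E : (rem g s) => [|u r]; last first.
    apply: (p_lead _ _ fgr g1).
    have us : u \in s by rewrite (mem_rem (x := g)) // E mem_head.
    have [u1 _] := sP u us.
    have r0 : \prod_(v <- u :: r) v != 0.
      by apply: contraNneq f0 => r0; rewrite fgr E r0 mulr0.
    rewrite E (leq_trans u1) // dvdp_leq // big_cons dvdp_mulr //.
  move: fgr; rewrite E big_nil mulr1 => <-.
  by rewrite dvdzE lcf -(prednK k_gt0) expnS -mulnA dvdn_mulr.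
(* Shifting by [m] preserves sizes and leading coefficients, so the product lemma applies to the
   shifted factors. *)
have dvd i : (p ^ (size s + i - n) %| `|f^`N(i).[m%:Z]|)%N.
  rewrite -[p]/(absz p%:Z) -abszX -dvdzE.
  rewrite shiftE.
  have -> : n = (size (f \Po ('X + m%:Z%:P))).-1 by rewrite size_shift f_deg.
  have -> : f \Po ('X + m%:Z%:P) =
      \prod_(g <- [seq g \Po ('X + m%:Z%:P) | g <- s]) g.
    by rewrite fs (rmorph_prod (comp_poly _)) big_map.
  rewrite -{1}(size_map (comp_poly ('X + m%:Z%:P)) s).
  apply: dvdn_coef_prod => _ /mapP[g gs ->]; have [g0 pg] := p_s g gs.
  by rewrite lc_shift -size_poly_gt0 size_shift size_poly_gt0.
(* At [i = n] this reads [p^r | p^k d] with [p] prime to [d]. *)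
have le_k : (size s <= k)%N.
  have := dvd n; rewrite addnK fnE lcf Gauss_dvdl ?dvdn_Pexp2l ?prime_gt1 //.
  by rewrite coprimeXl // prime_coprime.
have le_vp i : (i <= n)%N ->
    ((size s)%:Z%:E <= i%:Z%:E + vp p f^`N(n - i).[m%:Z])%E.
  move=> i_n; rewrite /vp; case: ifPn => [_|s_i0].
    by rewrite addey // leey.
  rewrite -EFinD lee_fin -PoszD lez_nat -leq_subLR -pfactor_dvdn ?absz_gt0 //.
  by have := dvd (n - i)%N; congr (_ ^ _ %| _)%N; lia.
split.
  exists s; split=> // [g /sP[]//|].
  rewrite big_nat; elim/big_ind: _ => [|u v su sv|i /andP[_ i_n]].
  - by rewrite lee_fin lez_nat.
  - by rewrite le_min su.
  - exact: le_vp.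
move=> hyp; have : (size s <= 1)%N.
  (* With at least two factors, the exponent [r + (n - 1) - n] would be positive. *)
  case: hyp => [<- //|pn]; rewrite leqNgt; apply: contra pn => s1.
  rewrite dvdzE; apply: dvdn_trans (dvd (n - 1)%N).
  by rewrite dvdn_exp // ; lia.
case: s s0 sP fs {p_s dvd le_k le_vp} => // g [|//] _ sP -> _.
by rewrite big_seq1; case: (sP g (mem_head _ _)).
Qed.
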